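(* In the logic Int2GC the following hold, where (FS1)--(FS4) are the axiom schemes (FS1) $\blacktriangle(A\to B)\to(\blacktriangledown A\to\blacktriangle B)$, (FS2) $\vartriangle(A\to B)\to(\triangledown A\to\vartriangle B)$, (FS3) $(\blacktriangle A\to\blacktriangledown B)\to\blacktriangledown(A\to B)$, (FS4) $(\vartriangle A\to\triangledown B)\to\triangledown(A\to B)$. (a) The axioms (FS1) and (FS4) are equivalent; that is, the extension of Int2GC by (FS1) proves every instance of (FS4), and the extension of Int2GC by (FS4) proves every instance of (FS1). (b) The axioms (FS2) and (FS3) are equivalent; that is, the extension of Int2GC by (FS2) proves every instance of (FS3), and the extension of Int2GC by (FS3) proves every instance of (FS2).
   Context: Formulas are built from a countably infinite set $\mathrm{Var}$ of propositional variables with the connectives $\neg,\vee,\wedge,\to$ and four unary connectives $\blacktriangle,\blacktriangledown,\vartriangle,\triangledown$. The logic Int2GC is the smallest set of formulas (called provable formulas) that contains intuitionistic propositional logic (in this language) and is closed under substitution, modus ponens, and the following four rules: from $A\to\triangledown B$ infer $\blacktriangle A\to B$; from $\blacktriangle A\to B$ infer $A\to\triangledown B$; from $A\to\blacktriangledown B$ infer $\vartriangle A\to B$; from $\vartriangle A\to B$ infer $A\to\blacktriangledown B$. The extension of Int2GC by an axiom scheme is the smallest set of formulas containing Int2GC and all instances of the scheme and closed under the same rules (substitution, modus ponens, and the four rules above). *)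

(* Defs.v *)
(** The propositional variables are indexed by [nat].  Negation is primitive,
    and there is no constant for falsity. *)
Inductive form : Type :=
  | Var (n : nat)
  | Neg (A : form)
  | Or (A B : form)
  | And (A B : form)
  | Imp (A B : form)
  | BlackUp (A : form)
  | BlackDown (A : form)
  | WhiteUp (A : form)
  | WhiteDown (A : form).

Declare Scope form_scope.
Delimit Scope form_scope with form.
Bind Scope form_scope with form.

Notation "¬ A" := (Neg A) (at level 35, right associativity) : form_scope.
Notation "▲ A" := (BlackUp A) (at level 35, right associativity) : form_scope.
Notation "▼ A" := (BlackDown A) (at level 35, right associativity) : form_scope.
Notation "△ A" := (WhiteUp A) (at level 35, right associativity) : form_scope.
Notation "▽ A" := (WhiteDown A) (at level 35, right associativity) : form_scope.
Notation "A ∧ B" := (And A B) (at level 80, right associativity) : form_scope.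
Notation "A ∨ B" := (Or A B) (at level 85, right associativity) : form_scope.
Notation "A → B" := (Imp A B) (at level 99, B at level 200, right associativity)
  : form_scope.

Open Scope form_scope.

Fixpoint subst (s : nat -> form) (A : form) : form :=
  match A with
  | Var n => s n
  | Neg A => ¬ subst s A
  | Or A B => subst s A ∨ subst s B
  | And A B => subst s A ∧ subst s B
  | Imp A B => subst s A → subst s B
  | BlackUp A => ▲ subst s A
  | BlackDown A => ▼ subst s A
  | WhiteUp A => △ subst s A
  | WhiteDown A => ▽ subst s A
  end.

(** A Hilbert calculus for intuitionistic propositional logic.  The
    metavariables range over all of [form], so formulas headed by one of the
    four unary connectives behave as atoms here. *)
Inductive Int : form -> Prop :=
  | Int_k A B : Int (A → B → A)
  | Int_s A B C : Int ((A → B → C) → (A → B) → A → C)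
  | Int_and_l A B : Int ((A ∧ B) → A)
  | Int_and_r A B : Int ((A ∧ B) → B)
  | Int_and_i A B : Int (A → B → (A ∧ B))
  | Int_or_l A B : Int (A → (A ∨ B))
  | Int_or_r A B : Int (B → (A ∨ B))
  | Int_or_e A B C : Int ((A → C) → (B → C) → (A ∨ B) → C)
  | Int_neg_i A B : Int ((A → B) → (A → ¬ B) → ¬ A)
  | Int_neg_e A B : Int (¬ A → A → B)
  | Int_mp A B : Int (A → B) -> Int A -> Int B.

Inductive Int2GC : form -> Prop :=
  | GC_int A : Int A -> Int2GC A
  | GC_subst s A : Int2GC A -> Int2GC (subst s A)
  | GC_mp A B : Int2GC (A → B) -> Int2GC A -> Int2GC B
  | GC_black_up A B : Int2GC (A → ▽ B) -> Int2GC (▲ A → B)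
  | GC_white_down A B : Int2GC (▲ A → B) -> Int2GC (A → ▽ B)
  | GC_white_up A B : Int2GC (A → ▼ B) -> Int2GC (△ A → B)
  | GC_black_down A B : Int2GC (△ A → B) -> Int2GC (A → ▼ B).

(** An axiom scheme is represented by the set [Ax] of all its instances. *)
Inductive Int2GC_ext (Ax : form -> Prop) : form -> Prop :=
  | ext_base A : Int2GC A -> Int2GC_ext Ax A
  | ext_ax A : Ax A -> Int2GC_ext Ax A
  | ext_subst s A : Int2GC_ext Ax A -> Int2GC_ext Ax (subst s A)
  | ext_mp A B : Int2GC_ext Ax (A → B) -> Int2GC_ext Ax A -> Int2GC_ext Ax B
  | ext_black_up A B : Int2GC_ext Ax (A → ▽ B) -> Int2GC_ext Ax (▲ A → B)
  | ext_white_down A B : Int2GC_ext Ax (▲ A → B) -> Int2GC_ext Ax (A → ▽ B)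
  | ext_white_up A B : Int2GC_ext Ax (A → ▼ B) -> Int2GC_ext Ax (△ A → B)
  | ext_black_down A B : Int2GC_ext Ax (△ A → B) -> Int2GC_ext Ax (A → ▼ B).

Inductive FS1 : form -> Prop :=
  | FS1_inst A B : FS1 (▲ (A → B) → (▼ A → ▲ B)).

Inductive FS2 : form -> Prop :=
  | FS2_inst A B : FS2 (△ (A → B) → (▽ A → △ B)).

Inductive FS3 : form -> Prop :=
  | FS3_inst A B : FS3 ((▲ A → ▼ B) → ▼ (A → B)).

Inductive FS4 : form -> Prop :=
  | FS4_inst A B : FS4 ((△ A → ▽ B) → ▽ (A → B)).

(* Main.v *)
Require Import Defs.

(** Both parts are one fact about two Galois connections [u ⊣ d] and [u' ⊣ d']
    on the preorder of provable implication:
    [u (A → B) → (d' A → u B)] and [(u' A → d B) → d (A → B)] are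
    interderivable.  Transpose the wanted formula along [u ⊣ d], instantiate the
    scheme at the images of [A] and [B], and rewrite with the unit of one
    connection and the counit of the other.  Part (a) takes [▲ ⊣ ▽] for [u ⊣ d]
    and [△ ⊣ ▼] for [u' ⊣ d']; part (b) exchanges the two. *)

(** K, S and modus ponens make provable implication a preorder in which [→] is antitone on the left
    and monotone on the right. *)
Record implicative (T : form -> Prop) : Prop := {
  imp_k : forall A B, T (A → B → A);
  imp_s : forall A B C, T ((A → B → C) → (A → B) → A → C);
  imp_mp : forall A B, T (A → B) -> T A -> T B
}.

(** The adjunction relates theorems, as the rules of the calculus do; it is not an implication
    inside the logic. *)
Definition galois (T : form -> Prop) (u d : form -> form) : Prop :=
  forall A B, T (A → d B) <-> T (u A → B).

Lemma imp_id T (HT : implicative T) A : T (A → A).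
Proof.
  destruct HT as [k s mp].
  exact (mp _ _ (mp _ _ (s A (A → A) A) (k A (A → A))) (k A A)).
Qed.

Lemma imp_trans T (HT : implicative T) A B C :
  T (A → B) -> T (B → C) -> T (A → C).
Proof.
  destruct HT as [k s mp]; intros HAB HBC.
  exact (mp _ _ (mp _ _ (s A B C) (mp _ _ (k _ A) HBC)) HAB).
Qed.

Lemma imp_mono_r T (HT : implicative T) A B C :
  T (B → C) -> T ((A → B) → (A → C)).
Proof.
  intros HBC; apply (imp_mp T HT) with (A → B → C).
  - apply (imp_s T HT).
  - apply (imp_mp T HT) with (B → C); [apply (imp_k T HT) | exact HBC].
Qed.

Lemma imp_mono_l T (HT : implicative T) A B C :
  T (A → B) -> T ((B → C) → (A → C)).
Proof.
  intros HAB; destruct (HT) as [k s mp].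
  apply (imp_trans T HT) with (A → B → C); [apply k |].
  (* S applied to an instance of S carries the hypothesis [A → B → C] along, while K weakens [A → B]
     by it. *)
  apply mp with ((A → B → C) → (A → B)).
  - apply mp with ((A → B → C) → (A → B) → A → C); [apply s | apply s].
  - apply mp with (A → B); [apply k | exact HAB].
Qed.

Lemma imp_mono T (HT : implicative T) A A' B B' :
  T (A' → A) -> T (B → B') -> T ((A → B) → (A' → B')).
Proof.
  intros HA HB; apply (imp_trans T HT) with (A' → B).
  - apply (imp_mono_l T HT), HA.
  - apply (imp_mono_r T HT), HB.
Qed.

Lemma galois_unit T (HT : implicative T) u d (G : galois T u d) A :
  T (A → d (u A)).
Proof. apply G, (imp_id T HT). Qed.

Lemma galois_counit T (HT : implicative T) u d (G : galois T u d) A :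
  T (u (d A) → A).
Proof. apply G, (imp_id T HT). Qed.

Lemma fischer_servi_lower T (HT : implicative T) u d u' d'
    (G : galois T u d) (G' : galois T u' d') :
  (forall A B, T (u (A → B) → (d' A → u B))) ->
  forall A B, T ((u' A → d B) → d (A → B)).
Proof.
  intros H A B; apply G.
  (* The scheme at [u' A] and [d B]; the unit at [A] and the counit at [B] then strip the added
     operators. *)
  apply (imp_trans T HT) with (d' (u' A) → u (d B)); [apply H |].
  apply (imp_mono T HT).
  - apply (galois_unit T HT u' d' G').
  - apply (galois_counit T HT u d G).
Qed.

Lemma fischer_servi_upper T (HT : implicative T) u d u' d'
    (G : galois T u d) (G' : galois T u' d') :
  (forall A B, T ((u' A → d B) → d (A → B))) ->
  forall A B, T (u (A → B) → (d' A → u B)).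
Proof.
  intros H A B; apply G.
  (* Dually, the operators are added first, and the scheme at [d' A] and [u B] finishes. *)
  apply (imp_trans T HT) with (u' (d' A) → d (u B)); [| apply H].
  apply (imp_mono T HT).
  - apply (galois_counit T HT u' d' G').
  - apply (galois_unit T HT u d G).
Qed.

Lemma ext_implicative Ax : implicative (Int2GC_ext Ax).
Proof.
  split.
  - intros A B; apply ext_base, GC_int, Int_k.
  - intros A B C; apply ext_base, GC_int, Int_s.
  - apply ext_mp.
Qed.

(** The extension is itself closed under the rules, so transposition also applies to theorems
    derived from the scheme. *)
Lemma ext_galois_black_up Ax : galois (Int2GC_ext Ax) BlackUp WhiteDown.
Proof. split; [apply ext_black_up | apply ext_white_down]. Qed.

Lemma ext_galois_white_up Ax : galois (Int2GC_ext Ax) WhiteUp BlackDown.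
Proof. split; [apply ext_white_up | apply ext_black_down]. Qed.

Theorem proposition2p1 :
  (* (a) *)
  ((forall F : form, FS4 F -> Int2GC_ext FS1 F) /\
   (forall F : form, FS1 F -> Int2GC_ext FS4 F)) /\
  (* (b) *)
  ((forall F : form, FS3 F -> Int2GC_ext FS2 F) /\
   (forall F : form, FS2 F -> Int2GC_ext FS3 F)).
Proof.
  pose proof ext_implicative as HT.
  pose proof ext_galois_black_up as Gb.
  pose proof ext_galois_white_up as Gw.
  split; split; intros F [A B].
  - apply (fischer_servi_lower _ (HT _) _ _ _ _ (Gb _) (Gw _)).
    intros; apply ext_ax, FS1_inst.
  - apply (fischer_servi_upper _ (HT _) _ _ _ _ (Gb _) (Gw _)).
    intros; apply ext_ax, FS4_inst.
  - apply (fischer_servi_lower _ (HT _) _ _ _ _ (Gw _) (Gb _)).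
    intros; apply ext_ax, FS2_inst.
  - apply (fischer_servi_upper _ (HT _) _ _ _ _ (Gw _) (Gb _)).
    intros; apply ext_ax, FS3_inst.
Qed.
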